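(* Let $D(p,q)$ for integers $p,q\ge0$ denote the Delannoy numbers, defined by the generating function \[ \frac{1}{1-x-y-xy}=\sum_{p,q=0}^\infty D(p,q)x^py^q, \] and let $D(n)=D(n,n)$ denote the central Delannoy numbers. For integers $p,q\ge0$, \[ D(p,q)=\frac{(-1)^q}{q!}\det\begin{pmatrix}L_{(q+1)\times1}(p) & M_{(q+1)\times q}(p)\end{pmatrix}, \] where the $(q+1)\times(q+1)$ matrix is formed by placing the column $L_{(q+1)\times1}(p)=\bigl(\langle p\rangle_0,\langle p\rangle_1,\dotsc,\langle p\rangle_q\bigr)^T$ to the left of the $(q+1)\times q$ matrix \[ M_{(q+1)\times q}(p)=\Bigl((-1)^{i-j}\binom{i-1}{j-1}\langle p+1\rangle_{i-j}\Bigr)_{1\le i\le q+1,\ 1\le j\le q}, \] whose entries with $i<j$ are $0$. (For $q=0$ the matrix is the $1\times1$ matrix $(\langle p\rangle_0)$.) Consequently, for $n\ge0$, \[ D(n)=\frac{(-1)^n}{n!}\det\begin{pmatrix}L_{(n+1)\times1}(n) & M_{(n+1)\times n}(n)\end{pmatrix}. \]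
   Context: For $z\in\mathbb{C}$ and an integer $n\ge0$, $\langle z\rangle_n$ denotes the falling factorial: $\langle z\rangle_n=z(z-1)\dotsm(z-n+1)$ for $n\ge1$ and $\langle z\rangle_0=1$. The binomial coefficient $\binom{i-1}{j-1}$ is $0$ when $j>i$. Equivalently to the generating function definition, $D(p,q)=\sum_{i=0}^{p}\binom{p}{i}\binom{q}{i}2^i$. *)

(* Defs.v *)
From HB Require Import structures.
From mathcomp Require Import all_boot all_order all_algebra.
Set Implicit Arguments. Unset Strict Implicit. Unset Printing Implicit Defensive.
Import Order.TTheory GRing.Theory Num.Theory.
Local Open Scope ring_scope.

(* In {poly {poly R}}, u`_i`_j is the coefficient of 'X^i * 'Y^j, where 'X is
   the outer variable and 'Y := 'X%:P (see polyXY).                           *)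

(* [rational_genfun N P a]: N / P = \sum_(p, q) a p q x^p y^q as formal power
   series in x, y, i.e. N is the Cauchy product of P and the series of a.  The
   quotient is meaningful when the constant term P`_0`_0 is invertible.       *)
Definition rational_genfun (R : nzRingType) (N P : {poly {poly R}})
    (a : nat -> nat -> R) : Prop :=
  forall p q : nat,
    \sum_(i < p.+1) \sum_(j < q.+1) P`_i`_j * a (p - i)%N (q - j)%N = N`_p`_q.

Definition delannoy_numbers (R : nzRingType) (D : nat -> nat -> R) : Prop :=
  rational_genfun 1 (1 - 'X - 'Y - 'X * 'Y) D.

Definition falling (R : nzRingType) (z : R) (n : nat) : R :=
  \prod_(k < n) (z - k%:R).

Definition Lcol (R : nzRingType) (z : R) (q : nat) : 'cV[R]_(q.+1) :=
  \col_i falling z i.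

(* Indices start at 0, so the usual (i-1 choose j-1) is 'C(i, j).
   For i < j the subtraction i - j truncates to 0, but then 'C(i, j) = 0 and
   the entry is 0.                                                            *)
Definition Mmat (R : nzRingType) (z : R) (q : nat) : 'M[R]_(q.+1, q) :=
  \matrix_(i < q.+1, j < q)
    ((-1) ^+ (i - j) * 'C(i, j)%:R * falling (z + 1) (i - j)).

Definition LMmat (R : nzRingType) (z : R) (q : nat) : 'M[R]_(q.+1) :=
  row_mx (Lcol z q) (Mmat z q).

Lemma delannoy_coef (R : nzRingType) (i j : nat) :
  (1 - 'X - 'Y - 'X * 'Y : {poly {poly R}})`_i`_j =
  ((i == 0) && (j == 0))%N%:R - ((i == 1) && (j == 0))%N%:R
  - ((i == 0) && (j == 1))%N%:R - ((i == 1) && (j == 1))%N%:R.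
Proof.
rewrite !coefB coef1 coefX coefC coefXM.
case: i => [|[|i]]; rewrite /= ?coefC /= ?coef1 ?coefX ?coef0 //=;
  by case: j => [|[|j]]; rewrite ?coefX ?coef1 ?coefC ?coef0 /= ?mulr0n ?mulr1n ?subr0.
Qed.

Lemma sum_delta2 (R : nzRingType) (a : nat -> nat -> R) (p q k l : nat) :
  \sum_(i < p.+1) \sum_(j < q.+1)
     (((i == k :> nat) && (j == l :> nat))%:R * a (p - i)%N (q - j)%N) =
  if ((k <= p) && (l <= q))%N then a (p - k)%N (q - l)%N else 0.
Proof.
have [kp|kp] /= := leqP k p; last first.
  apply: big1 => i _; apply: big1 => j _.
  by rewrite (ltn_eqF (leq_trans (ltn_ord i) kp)) mul0r.
rewrite (bigD1 (inord k)) //= [X in _ + X]big1 ?addr0; last first.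
  move=> i ik; apply: big1 => j _; case: eqP => [e|_]; last by rewrite mul0r.
  by move: ik; rewrite -e inord_val eqxx.
rewrite inordK ?ltnS // eqxx /=.
have [lq|lq] := leqP l q; last first.
  by apply: big1 => j _; rewrite (ltn_eqF (leq_trans (ltn_ord j) lq)) mul0r.
rewrite (bigD1 (inord l)) //= [X in _ + X]big1 ?addr0; last first.
  move=> j jl; case: eqP => [e|_]; last by rewrite mul0r.
  by move: jl; rewrite -e inord_val eqxx.
by rewrite inordK ?ltnS // eqxx mul1r.
Qed.

Lemma delannoy_numbersP (R : nzRingType) (D : nat -> nat -> R) :
  delannoy_numbers D <->
  forall p q : nat, D p q =
    ((p == 0) && (q == 0))%N%:R
    + (if ((0 < p) && (0 < q))%N then D p.-1 q.-1 else 0)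
    + (if (0 < q)%N then D p q.-1 else 0)
    + (if (0 < p)%N then D p.-1 q else 0).
Proof.
have E p q : \sum_(i < p.+1) \sum_(j < q.+1)
      (1 - 'X - 'Y - 'X * 'Y : {poly {poly R}})`_i`_j * D (p - i)%N (q - j)%N =
    D p q - (if (0 < p)%N then D p.-1 q else 0)
    - (if (0 < q)%N then D p q.-1 else 0)
    - (if ((0 < p) && (0 < q))%N then D p.-1 q.-1 else 0).
  under eq_bigr => i _ do under eq_bigr => j _ do
    rewrite delannoy_coef !mulrBl.
  under eq_bigr => i _ do rewrite !sumrB.
  by rewrite !sumrB !sum_delta2 !leq0n /= ?andbT !subn0 !subn1.
have C p q : (1 : {poly {poly R}})`_p`_q = ((p == 0) && (q == 0))%N%:R.
  by rewrite coef1; case: p => [|p]; rewrite ?coef1 ?coef0.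
split=> H p q; have := H p q; rewrite ?E ?C.
- by move=> <-; rewrite !subrK.
- by move=> ->; rewrite !addrK.
Qed.

Fixpoint delannoy_rec (R : nzRingType) (p : nat) : nat -> R :=
  if p is p'.+1 then
    fix row (q : nat) : R :=
      if q is q'.+1
      then delannoy_rec R p' q' + row q' + delannoy_rec R p' q
      else delannoy_rec R p' 0
  else fun=> 1.

Lemma delannoy_numbers_exist (R : nzRingType) :
  delannoy_numbers (@delannoy_rec R).
Proof.
by apply/delannoy_numbersP => -[|p] [|q] //=; rewrite ?addr0 ?add0r.
Qed.

Lemma delannoy_numbers_unique (R : nzRingType) (D D' : nat -> nat -> R) :
  delannoy_numbers D -> delannoy_numbers D' -> forall p q, D p q = D' p q.
Proof.
move=> /delannoy_numbersP H /delannoy_numbersP H'.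
elim=> [|p IHp]; elim=> [|q IHq]; rewrite H H' //= ?IHp ?IHq //.
Qed.

(* Main.v *)
Require Import Defs.
From HB Require Import structures.
From mathcomp Require Import all_boot all_order all_algebra.
From mathcomp Require Import ring.
Set Implicit Arguments. Unset Strict Implicit. Unset Printing Implicit Defensive.
Import Order.TTheory GRing.Theory Num.Theory.
Local Open Scope ring_scope.

(* The p-th row of the Delannoy array has the generating function
   f = (1 + y)^p / (1 - y)^(p+1).  Differentiating f (1 - y)^(p+1) = (1 + y)^p
   repeatedly at y = 0 by the Leibniz rule gives a unitriangular linear system
   for the numbers k! D(p, k), with matrix
   T = ((-1)^(i-j) 'C(i, j) <p+1>_(i-j)) and right-hand side L.  Since M
   consists of the first q columns of T, Cramer's rule for the last unknown
   q! D(p, q) is the determinant of (L M) up to a cyclic shift of columns.    *)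

Lemma falling_natr (R : nzRingType) (n i : nat) :
  falling (n%:R : R) i = (n ^_ i)%:R.
Proof.
rewrite /falling; elim: i => [|i IHi]; first by rewrite big_ord0.
rewrite big_ord_recr /= IHi ffactnSr natrM.
case: (leqP i n) => [le_in|lt_ni]; first by rewrite natrB.
by rewrite ffact_small // !mul0r.
Qed.

Lemma coef_exp_1DZX (R : comNzRingType) (c : R) (n i : nat) :
  ((1 + c *: 'X) ^+ n)`_i = c ^+ i * 'C(n, i)%:R.
Proof.
elim: n i => [|n IHn] i.
  by rewrite expr0 coef1 bin0n; case: i => [|i]; rewrite ?expr0 ?mulr1 ?mulr0.
rewrite exprS mulrDl mul1r -scalerAl coefD coefZ coefXM IHn.
case: i => [|i] /=; first by rewrite !bin0 mulr0 addr0.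
by rewrite IHn binS natrD exprS mulrA -mulrDr.
Qed.

(** Power series in y are replaced by polynomials modulo y^(n+1), with [r] absorbing the truncation
    error. The induction rests on the recurrence read row by row: (1 - y) f_(p+1) = (1 + y) f_p. *)
Lemma delannoy_row_genfun (R : comNzRingType) (D : nat -> nat -> R)
    (p n : nat) : delannoy_numbers D ->
  exists r : {poly R},
    (1 - 'X) ^+ p.+1 * \poly_(j < n.+1) D p j = (1 + 'X) ^+ p + r * 'X^(n.+1).
Proof.
move=> /delannoy_numbersP recD; elim: p => [|p [r IHp]].
- exists (- (D 0 n)%:P); rewrite expr0 expr1.
  apply/polyP=> -[|i]; rewrite mulrBl mul1r mulNr coefB coefXM coefD coef1
    coefN coefCM coefXn !coef_poly /=.
    by rewrite recD /= mulr0 !addr0.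
  rewrite eqSS !ltnS; case: ltngtP => [lt_in|lt_ni|->] /=; last first.
  + by rewrite mulr1.
  + by rewrite mulr0 !subrr.
  + by rewrite recD /= !add0r addr0 mulr0 !subrr oppr0.
(* Cutting both rows at degree n breaks the row relation only in degree n+1: the left side has -
   D(p+1, n) there and (1 + y) f_p has D(p, n). *)
- pose c : R := D p.+1 n + D p n.
  have step : (1 - 'X) * \poly_(j < n.+1) D p.+1 j
      = (1 + 'X) * \poly_(j < n.+1) D p j - c%:P * 'X^(n.+1).
    apply/polyP=> -[|i]; rewrite mulrBl mulrDl !mul1r !coefB !coefD !coefXM
      coefCM coefXn !coef_poly /=.
      by rewrite (recD p.+1) /= mulr0 !addr0 !add0r.
    rewrite eqSS !ltnS; case: ltngtP => [lt_in|lt_ni|->] /=.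
    + by rewrite (recD p.+1) /=; ring.
    + by ring.
    + by rewrite /c; ring.
  exists ((1 + 'X) * r - (1 - 'X) ^+ p.+1 * c%:P).
  rewrite exprSr -mulrA step mulrBr mulrCA IHp [in RHS]exprS; ring.
Qed.

(** The last row is zero outside its first entry, whose minor is the identity. *)
Lemma det_row_mx_unit (R : comNzRingType) (q : nat) (f : 'cV[R]_q.+1) :
  \det (row_mx f (\matrix_(i < q.+1, j < q) (i == j :> nat)%:R) : 'M_q.+1)
  = (-1) ^+ q * f ord_max 0.
Proof.
rewrite (expand_det_row _ ord_max) (bigD1 ord0) //= big1 ?addr0; last first.
  move=> j; rewrite mxE; case: splitP => [k ek|k _].
    by rewrite -val_eqE /= ek ord1.
  by rewrite mxE /= gtn_eqF // mul0r.
rewrite mxE; case: splitP => [k _|//]; rewrite ord1 /cofactor addn0 mulrC.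
rewrite (_ : row' _ _ = 1%:M) ?det1 ?mulr1 //.
apply/matrixP=> i j; rewrite !mxE.
case: splitP => [l|l] /=; rewrite /bump /=; first by rewrite ord1.
by move=> /addnI ejl; rewrite mxE lift_max -val_eqE /= ejl.
Qed.

(** Instead of differentiating i times, compare coefficients of y^i and multiply by i!; [i <= n]
    keeps clear of the remainder. *)
Lemma delannoy_leibniz (R : comNzRingType) (D : nat -> nat -> R)
    (p n i : nat) : delannoy_numbers D -> (i <= n)%N ->
  \sum_(j < n.+1) (-1) ^+ (i - j) * 'C(i, j)%:R * falling (p%:R + 1) (i - j)
     * (j`!%:R * D p j) = falling (p%:R : R) i.
Proof.
move=> hD le_in; have [r /(congr1 (fun u : {poly R} => u`_i))] :=
  delannoy_row_genfun p n hD.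
rewrite coefD coefMXn ltnS le_in addr0 coefMr.
rewrite -[X in (1 + X) ^+ p]scale1r -scaleN1r !coef_exp_1DZX expr1n mul1r => E.
rewrite falling_natr -bin_ffact natrM -E big_distrl /=.
(* Convolution stops at j = i. The sum to be matched runs to n, but its terms with j > i vanish
   through 'C(i, j), although i - j truncates to 0. *)
rewrite (big_ord_widen n.+1 (fun j => ((1 + -1 *: 'X) ^+ p.+1)`_(i - j)
  * (\poly_(j0 < n.+1) D p j0)`_j * i`!%:R)) // [RHS]big_mkcond /=.
apply: eq_bigr => j _; rewrite ltnS coef_exp_1DZX coef_poly ltn_ord.
case: leqP => [le_ji|lt_ij]; last by rewrite bin_small // mulr0 !mul0r.
rewrite natr1 falling_natr -bin_ffact -(bin_fact le_ji) !natrM; ring.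
Qed.

Lemma det_LMmat (R : comNzRingType) (D : nat -> nat -> R) (p q : nat) :
  delannoy_numbers D ->
  \det (LMmat (p%:R : R) q) = (-1) ^+ q * (q`!%:R * D p q).
Proof.
move=> hD.
pose T : 'M[R]_q.+1 := \matrix_(i, j)
  ((-1) ^+ (i - j) * 'C(i, j)%:R * falling (p%:R + 1) (i - j)).
pose f : 'cV[R]_q.+1 := \col_j (j`!%:R * D p j).
pose E : 'M[R]_(q.+1, q) := \matrix_(i, j) (i == j :> nat)%:R.
have detT : \det T = 1.
  rewrite det_trig; last first.
    by apply/is_trig_mxP=> i j lt_ij; rewrite mxE bin_small // mulr0 mul0r.
  by apply: big1 => i _; rewrite mxE subnn binn /falling big_ord0 !mulr1.
have Tf : T *m f = Lcol p%:R q.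
  apply/colP=> i; rewrite !mxE -(delannoy_leibniz p hD (ltnSE (ltn_ord i))).
  by apply: eq_bigr => j _; rewrite !mxE.
have TE : T *m E = Mmat p%:R q.
  apply/matrixP=> i j; rewrite !mxE (bigD1 (widen_ord (leqnSn q) j)) //=.
  rewrite big1 ?addr0 => [|k ne_kj]; rewrite !mxE /= ?eqxx ?mulr1 //.
  by move: ne_kj; rewrite -val_eqE /= => /negPf->; rewrite mulr0.
(* Cramer's rule as a factorization: [T] sends the unknowns [f] to L and the first q unit vectors to
   M. *)
have -> : LMmat (p%:R : R) q = T *m (row_mx f E : 'M_q.+1).
  by rewrite /LMmat -Tf -TE; exact: esym (mul_mx_row T f E).
by rewrite det_mulmx detT mul1r det_row_mx_unit mxE.
Qed.

Theorem theorem2p1 (R : numFieldType) (D : nat -> nat -> R)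
    (hD : delannoy_numbers D) :
  (forall p q : nat,
     D p q = (-1) ^+ q / (q`!)%:R * \det (LMmat (p%:R : R) q)) /\
  (forall n : nat,
     D n n = (-1) ^+ n / (n`!)%:R * \det (LMmat (n%:R : R) n)).
Proof.
suff main p q : D p q = (-1) ^+ q / (q`!)%:R * \det (LMmat (p%:R : R) q).
  by split=> [p q|n]; apply: main.
rewrite (det_LMmat p q hD) mulrCA !mulrA -exprMn mulN1r opprK expr1n mul1r.
by rewrite mulVf ?mul1r // pnatr_eq0 -lt0n fact_gt0.
Qed.
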